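(* Let $G=(V,E)$ be a tree with $|V|=n$, and let $V_b\subset V$ denote the set of its internal (branch) vertices. Then $$\mathscr{P}_{IUC}(G)=\Big\{x\in[0,1]^n \;:\; \sum_{i\in I}x_i+(|I|-1)x_v\le |I|,\ \ \forall v\in V_b,\ \forall I\subseteq N(v),\ |I|\ge 2\Big\}.$$
   Context: All graphs are finite, simple and undirected; $N(v)$ is the set of vertices adjacent to $v$. Internal (branch) vertices of a tree are its non-leaf vertices. A subset $U\subseteq V$ of the vertices of $G=(V,E)$ is an independent union of cliques (IUC) if every connected component of the induced subgraph $G[U]$ is a complete graph (equivalently, $G[U]$ has no induced path on three vertices). The IUC polytope $\mathscr{P}_{IUC}(G)\subseteq\mathbb{R}^{V}$ is the convex hull of the incidence vectors of all IUCs of $G$. *)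

(* Defs.v *)
From HB Require Import structures.
From mathcomp Require Import all_boot all_order all_algebra.
From mathcomp Require Import boolp classical_sets reals convex.

Set Implicit Arguments.
Unset Strict Implicit.
Unset Printing Implicit Defensive.

Import Order.TTheory GRing.Theory Num.Theory.

Local Open Scope classical_set_scope.
Local Open Scope ring_scope.

Record sgraph := SGraph {
  vertex :> finType;
  adj : rel vertex;
  adj_sym : symmetric adj;
  adj_irr : irreflexive adj }.

Section Graph.
Variable G : sgraph.

Definition neigh (v : G) : {set G} := [set w | adj v w]%SET.

Definition leaf (v : G) : bool := #|neigh v| == 1%N.

Definition branch_vertices : {set G} := [set v | ~~ leaf v]%SET.

Definition clique (C : {set G}) : Prop :=
  {in C &, forall u v : G, u != v -> adj u v}.

Definition components : {set {set G}} :=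
  equivalence_partition (connect (@adj G)) finset.setT.

Definition connected : Prop := #|components| = 1%N.

(* [ucycle] also accepts sequences of length 2 (an edge traversed back and
   forth), which are not graph cycles. *)
Definition acyclic : Prop :=
  forall c : seq G, ucycle (@adj G) c -> (size c < 3)%N.

(* [connected] requires exactly one component, so a tree is nonempty. *)
Definition is_tree : Prop := connected /\ acyclic.

Variable U : {set G}.

Definition induced_adj : rel {v : G | v \in U} := relpre val (@adj G).

Lemma induced_adj_sym : symmetric induced_adj.
Proof. by move=> u v; exact: adj_sym. Qed.

Lemma induced_adj_irr : irreflexive induced_adj.
Proof. by move=> u; exact: adj_irr. Qed.

Definition induced : sgraph := SGraph induced_adj_sym induced_adj_irr.

End Graph.

Definition iuc (G : sgraph) (U : {set G}) : Prop :=
  forall C : {set induced U}, C \in components (induced U) -> clique C.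

Definition convex_hull (R : numDomainType) (M : lmodType R) (A : set M) :
    set M :=
  smallest (@convex_set R M) A.

(* [R^o] is [R] as a module over itself; it is what makes [{ffun G -> R^o}]
   an [lmodType R]. *)
Definition incidence (R : realType) (G : sgraph) (U : {set G}) :
    {ffun G -> R^o} :=
  [ffun v => (v \in U)%:R].

Definition iuc_polytope (R : realType) (G : sgraph) : set {ffun G -> R^o} :=
  convex_hull [set incidence R U | U in [set U : {set G} | iuc U]].

Arguments iuc_polytope R G : clear implicits.

(* Main.v *)
(** In an acyclic graph a vertex set is an IUC iff each of its vertices has at
    most one neighbour in it. Summed over the neighbours [i] of [v] where it is
    positive, the inequality reads [sum_i max(0, x_i + x_v - 1) <= x_v]. This
    suffices to build, one leaf at a time, a random IUC [U] with marginals [x]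
    such that [P(u, v in U) = max(0, x_u + x_v - 1)] on every edge [uv]. To add
    a leaf [l] hanging at [v], put [l] in [U] with a constant conditional
    probability given that [v] is isolated in [U], and with another one given
    that [v] is not in [U]. The first event must have probability at least
    [max(0, x_l + x_v - 1)], which is the inequality at [v]; the second has
    probability [1 - x_v >= x_l - max(0, x_l + x_v - 1)]. *)

Require Import Defs.
From mathcomp Require Import all_boot all_order all_algebra.
From mathcomp Require Import boolp classical_sets reals convex.
From mathcomp Require Import interval_inference.
From mathcomp Require Import lra.

Set Implicit Arguments.
Unset Strict Implicit.
Unset Printing Implicit Defensive.

Import Order.TTheory GRing.Theory Num.Theory.

Local Open Scope classical_set_scope.
Local Open Scope ring_scope.

(** * Independent unions of cliques in acyclic graphs *)

Definition dissociated (G : sgraph) (U : {set G}) : Prop :=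
  {in U & &, forall v u w : G, adj v u -> adj v w -> u = w}.

Lemma connect_component (G : sgraph) (C : {set G}) (u v : G) :
  C \in components G -> u \in C -> v \in C -> connect (@adj G) u v.
Proof.
have sC : connect_sym (@adj G) by apply: sym_connect_sym; exact: adj_sym.
move=> /imsetP[x _ ->]; rewrite !inE /= => xu xv.
by apply: connect_trans xv; rewrite sC.
Qed.

Lemma component_exists (G : sgraph) (u v : G) : connect (@adj G) u v ->
  exists C : {set G}, [/\ C \in components G, u \in C & v \in C].
Proof.
move=> uv; exists [set w | connect (@adj G) u w]%SET.
split; rewrite ?inE//.
apply/imsetP; exists u; rewrite ?inE//.
by apply/setP => w; rewrite !inE.
Qed.

(** A walk in [induced U] can only go back and forth along one edge, so it ends at its start [u] or
    at a neighbour of [u]. *)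
Lemma dissociated_iuc (G : sgraph) (U : {set G}) : dissociated U -> iuc U.
Proof.
move=> dU C CU u v uC vC neq_uv.
have /connectP[p pth lst] := connect_component CU uC vC.
have : (last u p == u) || adj u (last u p).
  elim/last_ind: p pth {lst} => [|p w IHp]; first by rewrite eqxx.
  rewrite rcons_path last_rcons => /andP[/IHp + ew] => /predU1P[<-|uz].
    by rewrite ew orbT.
  apply/orP; left; apply/eqP/val_inj.
  apply: (dU (val (last u p))) => //; try exact: valP.
  by rewrite adj_sym.
by rewrite -lst eq_sym (negPf neq_uv).
Qed.

(** Two distinct neighbours of [v] in [U] lie in one component, hence are adjacent and form a
    triangle with [v]. *)
Lemma iuc_dissociated (G : sgraph) (U : {set G}) :
  acyclic G -> iuc U -> dissociated U.
Proof.
move=> acG iU v u w vU uU wU vu vw; apply/eqP/negPn/negP => neq_uw.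
pose u' : induced U := Sub u uU; pose v' : induced U := Sub v vU.
pose w' : induced U := Sub w wU.
have uw' : connect (@adj (induced U)) u' w'.
  apply: (@connect_trans _ _ v'); apply: connect1; last exact: vw.
  by rewrite adj_sym; exact: vu.
have [C [CU uC wC]] := component_exists uw'.
have uw : adj u w by apply: (iU _ CU u' w').
have /acG : ucycle (@adj G) [:: u; v; w]; last by [].
have neq_adj a b : adj a b -> a != b :> G.
  by apply: contraTneq => ->; rewrite adj_irr.
apply/andP; split; rewrite /=.
  by rewrite vw (adj_sym u) vu (adj_sym w) uw.
by rewrite !inE negb_or neq_uw !andbT (neq_adj _ _ vw) eq_sym neq_adj.
Qed.

(* The new neighbour of the head of a path either lies outside of the path or
   is the second vertex, since otherwise it closes a cycle. *)
Lemma acyclic_path_head (G : sgraph) (x w : G) (p : seq G) :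
  acyclic G -> uniq (x :: p) -> path (@adj G) x p -> adj x w -> w \in p ->
  w = head w p.
Proof.
move=> acG up pth xw /splitPr wp; case: wp up pth => p1 p2 up pth.
have /acG : ucycle (@adj G) (x :: rcons p1 w).
  move: up pth; rewrite -cat_rcons -cat_cons cat_uniq cat_path.
  move=> /andP[up _] /andP[pth _]; apply/andP; split => //=.
  by rewrite rcons_path pth last_rcons adj_sym.
by rewrite /= size_rcons !ltnS leqn0 size_eq0 => /eqP ->.
Qed.

(** Otherwise every vertex of [S] has two neighbours in [S], and a path can be prolonged at its head
    without end. *)
Lemma acyclic_leaf (G : sgraph) (S : {set G}) : acyclic G -> S != finset.set0 ->
  exists2 v, v \in S & {in S &, forall u w, adj v u -> adj v w -> u = w}.
Proof.
move=> acG /set0Pn[x0 x0S]; apply: contrapT => noleaf.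
have two x : x \in S -> exists u w,
    [/\ u \in S, w \in S, adj x u, adj x w & u != w].
  move=> xS; apply: contrapT => H; apply: noleaf; exists x => //.
  move=> u w uS wS xu xw.
  apply/eqP/negPn/negP => uw; apply: H; by exists u, w.
have long n : exists x p, [/\ x \in S, uniq (x :: p), path (@adj G) x p
    & size p = n].
  elim: n => [|n [x [p [xS up pth szp]]]]; first by exists x0, [::].
  have [u [w [uS wS xu xw uw]]] := two _ xS.
  (* If both neighbours were on the path, both would be its second vertex by [acyclic_path_head]. *)
  have [y [yS xy yp]] : exists y, [/\ y \in S, adj x y & y \notin p].
    have [up'|up'] := boolP (u \in p); last by exists u.
    have [wp'|wp'] := boolP (w \in p); last by exists w.
    have := acyclic_path_head acG up pth xu up'.
    have := acyclic_path_head acG up pth xw wp'.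
    case: p {up pth szp} up' wp' => //= a p _ _ wa ua.
    by rewrite ua wa eqxx in uw.
  exists y, (x :: p); split => //=; last by rewrite szp.
    rewrite inE negb_or yp andbT; apply/andP; split => //.
    by apply: contraTneq xy => ->; rewrite adj_irr.
  by rewrite adj_sym xy.
have [x [p [_ up _ szp]]] := long #|G|.
by have := max_card [in x :: p]; rewrite (card_uniqP up) /= szp ltnn.
Qed.

(** * Finite convex combinations *)

Lemma convex_set_sum (R : realType) (M : lmodType R) (A : set M) (T : finType)
    (mu : T -> R) (f : T -> M) :
  @convex_set R M A -> (forall t, 0 <= mu t) -> \sum_t mu t = 1 ->
  (forall t, A (f t)) -> A (\sum_t mu t *: f t).
Proof.
move=> cA mu0 mu1 Af.
(* The weights sum to 1, so [T] is inhabited; [f t0] serves as the point for a partial sum of total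
   weight 0. *)
have [t0 _] : exists t0 : T, True.
  apply: contrapT => noT; have := mu1; rewrite big1 => [/esym/eqP|t _].
    by rewrite oner_eq0.
  by case: noT; exists t.
(* Partial sums do not have weight 1, so the induction writes each one as its total weight times a
   point of [A]. *)
suff [y Ay ->] : exists2 y, A y &
    \sum_t mu t *: f t = (\sum_t mu t) *: y by rewrite mu1 scale1r.
elim: (index_enum T) => [|a s [y Ay IHs]].
  by exists (f t0) => //; rewrite !big_nil scale0r.
rewrite !big_cons IHs; set c := \sum_(j <- s) mu j.
have c0 : 0 <= c by apply: sumr_ge0.
have := mu0 a; rewrite le_eqVlt => /predU1P[<-|a0].
  by exists y => //; rewrite scale0r !add0r.
have ac0 : 0 < mu a + c by apply: ltr_wpDr.
pose l := mu a / (mu a + c).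
have l0 : 0 <= l by rewrite divr_ge0// ltW.
have l1 : l <= 1 by rewrite ler_pdivrMr// mul1r lerDl.
have := cA (f a) y (Itv01 l0 l1) (mem_set (Af a)) (mem_set Ay).
rewrite inE => Al; eexists; first exact: Al.
rewrite [RHS]scalerDr !scalerA /= mulrC divfK ?gt_eqF//.
congr (_ + _ *: _).
by rewrite mulrBr mulr1 mulrC divfK ?gt_eqF// [mu a + c]addrC addrK.
Qed.

(** * Random dissociated sets with prescribed marginals *)

(** The Fréchet lower bound: the least probability of the intersection of two events of
    probabilities [a] and [b]. *)
Definition overlap (R : realType) (a b : R) : R := Num.max 0 (a + b - 1).

Lemma overlapC (R : realType) (a b : R) : overlap a b = overlap b a.
Proof. by rewrite /overlap [a + b]addrC. Qed.

(* A random dissociated subset [U] of [S] that contains each vertex with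
   probability [x v] and both ends of each edge with the least probability that
   these marginals allow. *)
Definition is_coupling (R : realType) (G : sgraph) (x : G -> R) (S : {set G})
    (T : finType) (mu : T -> R) (U : T -> {set G}) : Prop :=
  [/\ [/\ forall t, 0 <= mu t, \sum_t mu t = 1,
      forall t, U t \subset S & forall t, dissociated (U t)],
      {in S, forall v, \sum_t mu t * (v \in U t)%:R = x v} &
      {in S &, forall u v, adj u v ->
        \sum_t mu t * ((u \in U t) && (v \in U t))%:R = overlap (x u) (x v)}].

Definition has_coupling (R : realType) (G : sgraph) (x : G -> R)
    (S : {set G}) : Prop :=
  exists (T : finType) (mu : T -> R) (U : T -> {set G}), is_coupling x S mu U.

(* Toss a coin of bias [c t] to decide whether [l] is added to [U t]. *)
Lemma coupling_extend (R : realType) (G : sgraph) (x : G -> R) (S : {set G})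
    (T : finType) (mu : T -> R) (U : T -> {set G}) (l : G) (c : T -> R) :
  is_coupling x S mu U -> l \notin S -> (forall t, 0 <= c t <= 1) ->
  (forall t, c t != 0 -> dissociated (l |: U t)) ->
  \sum_t mu t * c t = x l ->
  {in S, forall v, adj l v ->
    \sum_t mu t * (c t * (v \in U t)%:R) = overlap (x l) (x v)} ->
  has_coupling x (l |: S).
Proof.
move=> [[mu0 mu1 US dU] Ux Uxy] lS c01 dc cl cv.
pose nu (p : T * bool) := mu p.1 * (if p.2 then c p.1 else 1 - c p.1).
(* When [c t = 0], the index [(t, true)] has weight 0 but must still carry a dissociated set, whence
   the test on [c]. *)
pose W (p : T * bool) := if p.2 && (c p.1 != 0) then l |: U p.1 else U p.1.
have sumE (F : T * bool -> R) : \sum_p nu p * F p =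
    \sum_t mu t * (c t * F (t, true) + (1 - c t) * F (t, false)).
  transitivity (\sum_t \sum_b nu (t, b) * F (t, b)).
    by rewrite pair_bigA; apply: eq_bigr => -[].
  by apply: eq_bigr => t _; rewrite big_bool /nu /= [RHS]mulrDr !mulrA.
have lU t : l \notin U t by apply: contra lS; exact: (fintype.subsetP (US t)).
have inW v p : v \in S -> (v \in W p) = (v \in U p.1).
  move=> vS; rewrite /W; case: ifP => // _; rewrite !inE.
  by case: eqP vS lS => // -> ->.
have lW t b : (l \in W (t, b)) = b && (c t != 0).
  by rewrite /W /=; case: ifP => _; rewrite ?setU11// (negPf (lU _)).
have const a t : c t * a + (1 - c t) * a = a.
  by rewrite -mulrDl addrC subrK mul1r.
have cE t : c t * (c t != 0)%:R = c t.
  by have [->|] := eqVneq (c t) 0; rewrite ?mul0r ?mulr1.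
have lv v : v \in S -> adj l v ->
    \sum_p nu p * ((l \in W p) && (v \in W p))%:R = overlap (x l) (x v).
  move=> vS alv; rewrite sumE -(cv _ vS alv); apply: eq_bigr => t _.
  rewrite !lW !inW //= mulr0 addr0; congr (_ * _).
  by rewrite -mulnb natrM mulrA cE.
exists (T * bool)%type, nu, W; split; first split.
- move=> [t b]; rewrite /nu /= mulr_ge0//.
  by have /andP[c0 c1] := c01 t; case: b; rewrite ?subr_ge0.
- transitivity (\sum_p nu p * 1); first by under [RHS]eq_bigr do rewrite mulr1.
  rewrite sumE -[RHS]mu1; apply: eq_bigr => t _.
  by rewrite const mulr1.
- move=> [t b]; rewrite /W /=; case: ifP => _; first exact: finset.setUS.
  exact/(fintype.subset_trans (US t))/finset.subsetU1.
- move=> [t b]; rewrite /W /=; case: ifP => [/andP[_ /dc]|_] //; exact: dU.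
- move=> v /setU1P[->|vS]; rewrite sumE.
    rewrite -cl; apply: eq_bigr => t _.
    by rewrite !lW /= mulr0 addr0 cE.
  rewrite -(Ux v vS); apply: eq_bigr => t _.
  by rewrite !inW //= const.
- move=> u v /setU1P[->|uS] /setU1P[->|vS] auv.
  + by rewrite adj_irr in auv.
  + exact: lv.
  + rewrite overlapC -lv// 1?adj_sym//.
    by apply: eq_bigr => p _; rewrite andbC.
  + rewrite sumE -(Uxy u v uS vS auv); apply: eq_bigr => t _.
    by rewrite !inW //= const.
Qed.

Lemma dissociated_setU1 (G : sgraph) (l : G) (U : {set G}) :
  dissociated U -> {in U &, forall u w, adj l u -> adj l w -> u = w} ->
  {in U &, forall v w, adj l v -> ~~ adj v w} -> dissociated (l |: U).
Proof.
move=> dU lU lvU v u w /setU1P[->|vU].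
  move=> /setU1P[->|uU]; first by rewrite adj_irr.
  by move=> /setU1P[->|wU]; [rewrite adj_irr|exact: lU].
move=> /setU1P[->|uU] /setU1P[->|wU] // vu vw; last exact: dU vu vw.
  by have := lvU v w vU wU; rewrite (adj_sym l) vu vw => /(_ isT).
by have := lvU v u vU uU; rewrite (adj_sym l) vu vw => /(_ isT).
Qed.

(* The neighbours of [v] in [U] are exclusive events. *)
Lemma dissociated_isolated (R : realType) (G : sgraph) (v : G)
    (S U : {set G}) : dissociated U -> U \subset S ->
  ((v \in U) && [disjoint neigh v & U])%:R =
  (v \in U)%:R - \sum_(i in neigh v :&: S) ((i \in U) && (v \in U))%:R :> R.
Proof.
move=> dU /fintype.subsetP US; have [vU|vU] /= := boolP (v \in U); last first.
  by rewrite big1 ?subr0// => i _; rewrite andbF.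
case: (set_0Vmem (neigh v :&: U)) => [NU0|[i]].
  rewrite -finset.setI_eq0 NU0 eqxx big1 ?subr0// => i.
  rewrite !inE => /andP[vi _].
  have : i \notin neigh v :&: U by rewrite NU0 finset.in_set0.
  by rewrite !inE vi /= => /negPf ->.
rewrite !inE => /andP[vi iU].
have -> : [disjoint neigh v & U]%B = false.
  by apply/negbTE/pred0Pn; exists i; rewrite /= inE vi.
rewrite (bigD1 i) /=; last by rewrite !inE vi US.
rewrite iU big1 ?addr0 ?subrr// => j /andP[].
rewrite !inE => /andP[vj _] /eqP ji; rewrite andbT.
by have [jU|//] := boolP (j \in U); case: ji; apply: (dU v).
Qed.

(** * Adding a leaf to a coupling *)

Section LeafStep.
Variables (R : realType) (G : sgraph) (x : G -> R).
Hypothesis x01 : forall v, 0 <= x v <= 1.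
Hypothesis star : forall v (I : {set G}), I \subset neigh v ->
  \sum_(i in I) (x i + x v - 1) <= x v.

Lemma star_overlap (v : G) (I : {set G}) : I \subset neigh v ->
  \sum_(i in I) overlap (x i) (x v) <= x v.
Proof.
move=> Iv; rewrite (bigID (fun i => 0 <= x i + x v - 1)) /= [X in _ + X]big1.
  rewrite addr0.
  under eq_bigr => i /andP[_ i0] do rewrite /overlap (max_idPr i0).
  have /star : [set i in I | 0 <= x i + x v - 1]%SET \subset neigh v.
    apply: fintype.subset_trans Iv; apply/fintype.subsetP => i.
    by rewrite inE => /andP[].
  by apply: le_trans; under [leRHS]eq_bigl => i do rewrite inE.
by move=> i /andP[_]; rewrite -ltNge => /ltW/max_idPl.
Qed.

Lemma coupling_leaf (S : {set G}) (l : G) : l \notin S ->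
  {in S &, forall u w, adj l u -> adj l w -> u = w} ->
  has_coupling x S -> has_coupling x (l |: S).
Proof.
move=> lS leafl [T [mu [U cpl]]].
have [[mu0 mu1 US dU] Ux Uxy] := cpl.
have UinS t : {subset U t <= S} by exact/fintype.subsetP/US.
(* If [l] has no neighbour in [S], it is added independently of [U] with probability [x l]. *)
have [/exists_inP[v vS lv]|/exists_inPn noadj] :=
    boolP [exists v in S, adj l v]; last first.
  apply: (coupling_extend (c := fun=> x l) cpl) => //.
  - move=> t _; apply: dissociated_setU1 => //.
      by move=> u w /UinS uS _ lu; rewrite (negPf (noadj u uS)) in lu.
    by move=> u w /UinS uS _ lu; rewrite (negPf (noadj u uS)) in lu.
  - by rewrite -mulr_suml mu1 mul1r.
  - by move=> v vS lv; rewrite (negPf (noadj v vS)) in lv.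
pose A t := (v \in U t) && [disjoint neigh v & U t].
pose pA := \sum_t mu t * (A t)%:R.
pose z := overlap (x l) (x v).
have z0 : 0 <= z by rewrite le_max lexx.
have zx : x l - z <= 1 - x v.
  have : x l + x v - 1 <= z by rewrite le_max lexx orbT.
  lra.
have zl : z <= x l.
  by rewrite ge_max; have := x01 l; have := x01 v; lra.
(* Subtracting from [x v] the overlaps with the neighbours of [v] in [S] leaves [pA]; the star
   inequality for these neighbours together with [l] leaves room for [z]. *)
have zA : z <= pA.
  have -> : pA = x v - \sum_(i in neigh v :&: S) overlap (x i) (x v).
    rewrite -[X in X - _](Ux v vS).
    transitivity (\sum_t mu t * ((v \in U t)%:R -
        \sum_(i in neigh v :&: S) ((i \in U t) && (v \in U t))%:R)).
      by apply: eq_bigr => t _; rewrite -dissociated_isolated.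
    under eq_bigr do rewrite mulrBr mulr_sumr.
    rewrite sumrB exchange_big; congr (_ - _); apply: eq_bigr => i /=.
    by rewrite !inE => /andP[vi iS]; rewrite Uxy// adj_sym.
  have /star_overlap : (l |: (neigh v :&: S))%SET \subset neigh v.
    by rewrite finset.subUset finset.sub1set inE adj_sym lv finset.subsetIl.
  rewrite big_setU1 /=; last by rewrite !inE (negPf lS) andbF.
  by rewrite lerBrDr.
(* Division by 0 yields 0. If a denominator vanishes, so does its numerator, by [zA] or [zx], and
   [alE] and [beE] still hold. *)
pose al := z / pA; pose be := (x l - z) / (1 - x v).
have al01 : 0 <= al <= 1.
  rewrite /al; have [->|pA0] := eqVneq pA 0.
    by rewrite invr0 mulr0 lexx ler01.
  have pA_gt0 : 0 < pA by rewrite lt_def pA0 (le_trans z0).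
  by rewrite divr_ge0 ?(ltW pA_gt0)// ler_pdivrMr// mul1r.
have be01 : 0 <= be <= 1.
  rewrite /be; have [->|pB0] := eqVneq (1 - x v) 0.
    by rewrite invr0 mulr0 lexx ler01.
  have xv1 : 0 <= 1 - x v by have := x01 v; lra.
  have pB_gt0 : 0 < 1 - x v by rewrite lt_def pB0.
  by rewrite ler_pdivrMr// mul1r zx andbT divr_ge0// subr_ge0.
have alE : al * pA = z.
  rewrite /al; have [pA0|pA0] := eqVneq pA 0; last by rewrite divfK.
  by rewrite pA0 mulr0; apply: le_anti; rewrite z0 -pA0.
have beE : be * (1 - x v) = x l - z.
  rewrite /be; have [pB0|pB0] := eqVneq (1 - x v) 0; last by rewrite divfK.
  by rewrite pB0 mulr0; apply: le_anti; rewrite subr_ge0 zl -pB0.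
(* The bias is 0 when [v] already has a neighbour in [U t], since [l] would be a second one. The
   first term creates the joint probability [z] of [l] and [v], the second the remaining
   [x l - z]. *)
pose c t := al * (A t)%:R + be * (v \notin U t)%:R.
apply: (coupling_extend (c := c) cpl) => //.
- move=> t; rewrite /c /A; case: (v \in U t) => /=; last first.
    by rewrite mulr0 mulr1 add0r.
  by case: [disjoint _ & _]%B; rewrite /= ?mulr0 ?mulr1 addr0 ?lexx ?ler01.
- move=> t ct; apply: dissociated_setU1 => //.
    by move=> u w /UinS uS /UinS wS; exact: leafl.
  move=> u w uU wU lu.
  have uv : u = v by apply: leafl => //; exact: UinS uU.
  apply: contra ct => uw; rewrite /c /A -uv uU /= mulr0 addr0.
  suff -> : [disjoint neigh u & U t]%B = false by rewrite mulr0.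
  by apply/negbTE/pred0Pn; exists w; rewrite /= inE uw.
- under eq_bigr do rewrite /c mulrDr !(mulrCA (mu _)).
  rewrite big_split /= -!mulr_sumr alE.
  have -> : \sum_t mu t * (v \notin U t)%:R = 1 - x v.
    rewrite -[X in X - _]mu1 -(Ux v vS) -sumrB; apply: eq_bigr => t _.
    by case: (v \in U t); rewrite ?mulr1 ?mulr0 ?subrr ?subr0.
  by rewrite beE addrC subrK.
- move=> w wS lw; have -> : w = v by exact: leafl.
  rewrite -/z -alE mulr_sumr; apply: eq_bigr => t _.
  rewrite [RHS]mulrCA /c /A; case: (v \in U t) => /=.
    by rewrite mulr0 addr0 mulr1.
  by rewrite !mulr0.
Qed.

(** Induction on the size of [S], removing a vertex with at most one neighbour in [S]; the empty set
    carries a point mass. *)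
Lemma coupling_exists (S : {set G}) : acyclic G -> has_coupling x S.
Proof.
move=> acG; have [n] := ubnP #|S|; elim: n S => // n IHn S Sn.
have [->|/(acyclic_leaf acG)[l lS leafl]] := eqVneq S finset.set0.
  exists unit, (fun=> 1), (fun=> finset.set0); split; first split=> //.
  - by rewrite big_const card_unit /= addr0.
  - by move=> _ v u w; rewrite inE.
  - by move=> v; rewrite inE.
  - by move=> u v; rewrite inE.
rewrite -(finset.setD1K lS); apply: coupling_leaf.
- by rewrite !inE eqxx.
- by move=> u w /setD1P[_ uS] /setD1P[_ wS]; exact: leafl.
- by apply: IHn; move: Sn; rewrite (cardsD1 l) lS.
Qed.

End LeafStep.

(** * The polytope of the star inequalities *)

Section StarPolytope.
Variables (R : realType) (G : sgraph).

Definition star_polytope : set {ffun G -> R^o} :=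
  [set x : {ffun G -> R^o} |
    (forall v : G, 0 <= (x v : R) <= 1) /\
    (forall (v : G) (I : {set G}),
        v \in branch_vertices G -> I \subset neigh v -> (2 <= #|I|)%N ->
        \sum_(i in I) (x i : R) + (#|I|%:R - 1) * (x v : R) <= #|I|%:R)].

Lemma star_polytope_convex : @convex_set R {ffun G -> R^o} star_polytope.
Proof.
move=> x y k; rewrite !inE => -[x01 xI] [y01 yI].
pose l : R := k%:num.
have l0 : 0 <= l by rewrite /l.
have l1 : 0 <= 1 - l by rewrite subr_ge0 /l.
have E v : conv k x y v = l * x v + (1 - l) * y v by rewrite !ffunE.
split=> [v|v I vb Iv I2]; rewrite E.
  have /andP[x0 x1] := x01 v; have /andP[y0 y1] := y01 v.
  rewrite addr_ge0 ?mulr_ge0//=; nra.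
under eq_bigr do rewrite E.
rewrite big_split /= -!mulr_sumr.
have := xI v I vb Iv I2; have := yI v I vb Iv I2.
move: (\sum_(i in I) _) (\sum_(i in I) _) (#|I|%:R) => sy sx n Hy Hx.
have := ler_wpM2l l0 Hx; have := ler_wpM2l l1 Hy; lra.
Qed.

(** If [v] is in [U], then [I] meets [U] in at most one vertex, which offsets the [- 1] in the
    coefficient of [x v]. *)
Lemma star_polytope_incidence (U : {set G}) :
  dissociated U -> star_polytope (incidence R U).
Proof.
move=> dU; split=> [v|v I _ Iv _]; first by rewrite ffunE ler0n lern1 leq_b1.
under eq_bigr do rewrite ffunE.
have sumE : \sum_(i in I) (i \in U)%:R = #|I :&: U|%:R :> R.
  rewrite -natr_sum -big_mkcondr sum1_card.
  by congr _%:R; apply: eq_card => i; rewrite !inE.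
rewrite ffunE [X in X + _]sumE; have [vU|_] := boolP (v \in U); last first.
  by rewrite mulr0 addr0 ler_nat subset_leq_card// finset.subsetIl.
rewrite mulr1; suff : #|I :&: U|%:R <= 1 :> R by lra.
rewrite (ler_nat _ _ 1); apply/card_le1_eqP => a b.
rewrite !inE => /andP[/(fintype.subsetP Iv) + aU].
move=> + /andP[/(fintype.subsetP Iv) + bU].
by rewrite !inE => va vb; apply: (dU v).
Qed.

(* The inequalities for [#|I| <= 1] follow from the bounds on [x]. *)
Lemma star_polytope_star (x : {ffun G -> R^o}) (v : G) (I : {set G}) :
  star_polytope x -> I \subset neigh v ->
  \sum_(i in I) ((x i : R) + x v - 1) <= x v.
Proof.
move=> [x01 xI] Iv; have [I2|] := leqP 2 #|I|.
  (* Having two neighbours in [I], [v] is not a leaf, so the inequality at [v] is available. *)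
  have := xI v I _ Iv I2; rewrite inE /leaf gtn_eqF; last first.
    exact: leq_trans (subset_leq_card Iv).
  move=> /(_ isT).
  under [X in _ -> X <= _]eq_bigr do rewrite -addrA.
  rewrite big_split sumr_const /= -[(_ - 1) *+ _]mulr_natl; lra.
have /andP[v0 v1] := x01 v.
rewrite ltnS leq_eqVlt ltnS leqn0 => /orP[/cards1P[i ->]|/eqP/cards0_eq ->].
  by rewrite big_set1; have /andP[_] := x01 i; lra.
by rewrite big_set0.
Qed.

End StarPolytope.

Theorem theorem11 (R : realType) (G : sgraph) (treeG : is_tree G) :
  iuc_polytope R G =
  [set x : {ffun G -> R^o} |
    (forall v : G, 0 <= (x v : R) <= 1) /\
    (forall (v : G) (I : {set G}),
        v \in branch_vertices G -> I \subset neigh v -> (2 <= #|I|)%N ->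
        \sum_(i in I) (x i : R) + (#|I|%:R - 1) * (x v : R) <= #|I|%:R)].
Proof.
have [_ acG] := treeG; rewrite -/(@star_polytope R G); apply/seteqP; split.
  apply: smallest_sub; first exact: star_polytope_convex.
  by move=> _ [U iU <-]; exact/star_polytope_incidence/iuc_dissociated.
move=> x Px A [cA incA].
have [T [mu [U [[mu0 mu1 _ dU] Ux _]]]] :=
  coupling_exists Px.1 (fun v I => star_polytope_star (v := v) (I := I) Px)
    [set: G]%SET acG.
(* The marginals of the coupling on the whole vertex set say that [x] is the mean of the incidence
   vectors of the [U t], so any convex [A] containing these contains [x]. *)
have -> : x = \sum_t mu t *: incidence R (U t).
  apply/ffunP => v; rewrite sum_ffunE -[LHS](Ux v)//.
  by apply: eq_bigr => t _; rewrite !ffunE.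
apply: convex_set_sum => // t; apply: incA.
by exists (U t) => //; exact: dissociated_iuc.
Qed.
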